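(* Let $q$ be a prime power, $m$ a positive integer and $k\ge3$ an integer. A nondegenerate $[(k-1)m,k]_{q^m/q}$ minimal code exists if and only if $m\ge3$.
   Context: For $v\in\mathbb{F}_{q^m}^n$ and an ordered basis $\Gamma=(\gamma_1,\dots,\gamma_m)$ of $\mathbb{F}_{q^m}$ over $\mathbb{F}_q$, let $\Gamma(v)\in\mathbb{F}_q^{n\times m}$ be the matrix with $v_i=\sum_{j}\Gamma(v)_{ij}\gamma_j$. The rank support $\sigma^{\mathrm{rk}}(v)\subseteq\mathbb{F}_q^n$ is the column space of $\Gamma(v)$ (independent of $\Gamma$). An $[n,k]_{q^m/q}$ code is a $k$-dimensional $\mathbb{F}_{q^m}$-subspace $\mathcal{C}\subseteq\mathbb{F}_{q^m}^n$; it is nondegenerate if $\sum_{v\in\mathcal{C}}\sigma^{\mathrm{rk}}(v)=\mathbb{F}_q^n$, and minimal if for all $v,v'\in\mathcal{C}$, $\sigma^{\mathrm{rk}}(v')\subseteq\sigma^{\mathrm{rk}}(v)$ implies $v'=\alpha v$ for some $\alpha\in\mathbb{F}_{q^m}$. *)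

(* Defs.v *)
From HB Require Import structures.
From mathcomp Require Import all_boot all_order all_algebra all_field.

Set Implicit Arguments.
Unset Strict Implicit.
Unset Printing Implicit Defensive.

Import GRing.Theory.
Local Open Scope ring_scope.

Section RankMetricCodes.

Variables (F : finFieldType) (L : fieldExtType F).

Definition expansion m n (G : m.-tuple L) (v : 'rV[L]_n) : 'M[F]_(n, m) :=
  \matrix_(i, j) coord G j (v 0 i).

Definition column_space m n (A : 'M[F]_(n, m)) : {vspace 'cV[F]_n} :=
  <<[seq col j A | j : 'I_m]>>%VS.

Definition rank_support n (v : 'rV[L]_n) : {vspace 'cV[F]_n} :=
  column_space (expansion (vbasis {:L}) v).

Lemma column_space_expansion_sub m1 m2 n (G : m1.-tuple L) (D : m2.-tuple L)
    (v : 'rV[L]_n) : basis_of {:L} G ->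
  (column_space (expansion D v) <= column_space (expansion G v))%VS.
Proof.
move=> bG; apply/span_subvP => _ /imageP[j _ ->].
have -> : col j (expansion D v) =
    \sum_(l < m1) coord D j G`_l *: col l (expansion G v).
  apply/colP => i; rewrite summxE !mxE.
  rewrite {1}(coord_basis bG (memvf (v 0 i))) linear_sum.
  by apply: eq_bigr => l _; rewrite linearZ !mxE mulrC.
by apply: memv_suml => l _; apply/memvZ/memv_span/imageP; exists l.
Qed.

Lemma rank_supportE m n (G : m.-tuple L) (v : 'rV[L]_n) :
  basis_of {:L} G -> rank_support v = column_space (expansion G v).
Proof.
move=> bG; apply/eqP; rewrite eqEsubv.
by rewrite !column_space_expansion_sub ?vbasisP.
Qed.

(* [finvect_type L] is [L] itself, equipped with its finType structure. *)
Definition nondegenerate_code n (C : {vspace 'rV[L]_n}) : Prop :=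
  (\sum_(v : 'rV[finvect_type L]_n | (v : 'rV[L]_n) \in C)
     rank_support (v : 'rV[L]_n))%VS = fullv.

Definition minimal_code n (C : {vspace 'rV[L]_n}) : Prop :=
  forall v v' : 'rV[L]_n, v \in C -> v' \in C ->
    (rank_support v' <= rank_support v)%VS -> exists a : L, v' = a *: v.

End RankMetricCodes.

(* Main.v *)
(* Rank supports are compared through their annihilators: [lam] kills the
   support of [v] iff [\sum_i lam_i v_i = 0].

   If [m = 2], a dimension count over [F] gives two [F]-independent vectors
   [a], [b] of [F^n] inside a code of length [2(k-1)]; for [g] outside [F], the
   support of [a + g b] contains those of [a] and [b], so the code is not
   minimal. If [m = 1], the length [k-1] is less than the dimension.

   If [m >= 3], the columns of the generator matrix are taken to be an [F]-basis
   of an [F]-subspace [U] of [L^k] of codimension [m]. The code is minimal as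
   soon as [U] contains no [L]-subspace of [L]-codimension 2. Take for [U] the
   solutions of [m] conditions [coord_j(u_(min(j,2))) = 0]: these constrain
   three coordinates of [u], an [L]-subspace of codimension 2 contains a nonzero
   vector supported on them, and some [L]-multiple of it violates a condition. *)
Require Import Defs.
From HB Require Import structures.
From mathcomp Require Import all_boot all_order all_algebra all_field.
From mathcomp Require Import zify ring.

Set Implicit Arguments.
Unset Strict Implicit.
Unset Printing Implicit Defensive.

Import GRing.Theory.

Lemma dim_rowv (K : fieldType) (n : nat) : \dim {:'rV[K]_n} = n.
Proof. by rewrite dimvf dim_matrix; apply: mul1n. Qed.

(** * Rank supports and their annihilators *)

Section RankSupport.
Local Open Scope ring_scope.

Variables (F : finFieldType) (L : fieldExtType F) (n : nat).

Definition pairing (lam : 'rV[F]_n) (v : 'rV[L]_n) : L :=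
  \sum_i lam 0 i *: v 0 i.

(** The projection [p] onto a complement of [V] along [V] does not kill [c]; [lam] reads off an
    entry where [p c] is nonzero. *)
Lemma separating_functional (V : {vspace 'cV[F]_n}) (c : 'cV[F]_n) :
  c \notin V ->
  exists2 lam : 'rV[F]_n,
    (forall d, d \in V -> lam *m d = 0) & lam *m c != 0.
Proof.
move=> cV; pose p := daddv_pi V^C V.
have capV : (V^C :&: V = 0)%VS by rewrite capvC capv_compl.
have addV w : p w + daddv_pi V V^C w = w.
  by apply: daddv_pi_add => //; rewrite addvC addv_complf memvf.
have pV d : d \in V -> p d = 0.
  move=> dV; move: (addV d).
  rewrite [daddv_pi V V^C d]daddv_pi_id ?capv_compl //.
  by move/(canRL (addrK _)); rewrite subrr.
have pc : p c != 0.
  apply: contra cV => /eqP pc0; rewrite -(addV c) pc0 add0r; exact: memv_pi.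
have [i pci] : exists i, p c i 0 != 0 by apply/cV0Pn.
pose lam := \row_j p (delta_mx j 0) i 0.
have lamE d : lam *m d = (p d i 0)%:M.
  apply/rowP => j; rewrite !ord1 !mxE.
  have dE : d = \sum_j d j 0 *: delta_mx j 0.
    rewrite {1}[d]matrix_sum_delta; apply: eq_bigr => l _.
    by rewrite big_ord1.
  rewrite {2}dE linear_sum summxE mulr1n; apply: eq_bigr => l _.
  by rewrite linearZ !mxE mulrC.
exists lam => [d /pV pd0|]; first by rewrite lamE pd0 mxE raddf0.
by apply: contra pci => /eqP/matrixP/(_ 0 0); rewrite lamE !mxE mulr1n => ->.
Qed.

(** The products of [lam] with the columns generating the support are the coordinates of
    [pairing lam v], so one equation over [L] encodes them all. *)
Lemma rank_support_annihilator (lam : 'rV[F]_n) (v : 'rV[L]_n) :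
  (forall d, d \in rank_support v -> lam *m d = 0) <-> pairing lam v = 0.
Proof.
have coordE j : (lam *m col j (expansion (vbasis {:L}) v)) 0 0
    = coord (vbasis {:L}) j (pairing lam v).
  rewrite linear_sum mxE; apply: eq_bigr => i _.
  by rewrite linearZ !mxE.
split=> [kill|pair0].
  rewrite (coord_vbasis (memvf (pairing lam v))) big1 // => j _.
  by rewrite -coordE kill ?mxE ?scale0r //; apply/memv_span/image_f.
suff /subvP sub : (rank_support v <= lker (linfun (mulmx lam)))%VS.
  by move=> d /sub; rewrite memv_ker lfunE => /eqP.
apply/span_subvP => _ /imageP[j _ ->]; rewrite memv_ker lfunE /=.
by apply/eqP/rowP => i; rewrite !ord1 coordE pair0 linear0 mxE.
Qed.

Lemma rank_support_subP (v w : 'rV[L]_n) :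
  (rank_support w <= rank_support v)%VS <->
  forall lam, pairing lam v = 0 -> pairing lam w = 0.
Proof.
split=> [/subvP sub lam /rank_support_annihilator kill|sub].
  by apply/rank_support_annihilator => d /sub/kill.
apply/subvP => d dw; apply: contraT => /separating_functional[lam kill].
by move/rank_support_annihilator/sub/rank_support_annihilator: kill => ->;
  rewrite ?eqxx.
Qed.

(** A vector outside the sum of the supports would be separated from it by a nonzero [lam] pairing
    to 0 with all of [C]. *)
Lemma nondegenerate_codeP (C : {vspace 'rV[L]_n}) :
  (forall lam, (forall v, v \in C -> pairing lam v = 0) -> lam = 0) ->
  nondegenerate_code C.
Proof.
move=> inj; apply/eqP; rewrite eqEsubv subvf; apply/subvP => c _.
apply: contraT => /separating_functional[lam kill].
rewrite (inj lam) ?mul0mx ?eqxx // => v vC.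
apply/rank_support_annihilator => d dv; apply: kill.
move: d dv; apply/subvP.
exact: (@sumv_sup _ _ _ (v : 'rV[finvect_type L]_n)).
Qed.

End RankSupport.

(** * Extension degree two *)

Section DegreeTwo.
Local Open Scope ring_scope.

Variables (F : finFieldType) (L : fieldExtType F) (n : nat).

(** [K] is the kernel of the [F]-linear map sending a vector of [F^n] to its class modulo [C], whose
    target has [F]-dimension [(n - \dim C) * \dim {:L}]. *)
Lemma rational_points_dim (C : {vspace 'rV[L]_n}) :
  exists2 K : {vspace 'rV[F]_n},
    (forall a, a \in K -> map_mx (in_alg L) a \in C) &
    (n <= \dim K + (n - \dim C) * \dim {:L})%N.
Proof.
pose c := \dim (C^C)%VS; pose p := daddv_pi C^C C.
pose f (a : 'rV[F]_n) : {ffun 'I_c -> L} :=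
  [ffun j => coord (vbasis C^C%VS) j (p (map_mx (in_alg L) a))].
have f_lin : linear f.
  move=> x a b; apply/ffunP => j; rewrite !ffunE map_mxD map_mxZ !linearP.
  by rewrite /= -scalerAl mul1r.
pose fl : {linear 'rV[F]_n -> {ffun 'I_c -> L}} :=
  HB.pack f (GRing.isLinear.Build _ _ _ _ f f_lin).
exists (lker (linfun fl)) => [a|].
  rewrite memv_ker lfunE /= => /eqP fa0.
  set v := map_mx _ a.
  have pv0 : p v = 0.
    rewrite (coord_vbasis (memv_pi C^C C v)) big1 // => j _.
    by move/ffunP/(_ j): fa0; rewrite !ffunE => ->; rewrite scale0r.
  have := @daddv_pi_add _ _ C^C C v.
  rewrite capvC capv_compl addvC addv_complf memvf => /(_ erefl isT) <-.
  by rewrite [daddv_pi C^C C v]pv0 add0r memv_pi.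
have dimn : n = (\dim (lker (linfun fl)) + \dim (limg (linfun fl)))%N.
  by rewrite -{1}(dim_rowv F n) -(limg_ker_dim (linfun fl) fullv) capfv.
rewrite {1}dimn leq_add2l; apply: leq_trans (dimvS (subvf _)) _.
rewrite !dimvf /dim /= card_ord -/(dim L) /c dimv_compl dim_rowv.
by rewrite -(dimvf L).
Qed.

Lemma quadratic_not_minimal (C : {vspace 'rV[L]_n}) :
  \dim {:L} = 2 -> (2 + (n - \dim C) * 2 <= n)%N -> ~ minimal_code C.
Proof.
move=> m2 le_n minC.
have [K KC] := rational_points_dim C.
rewrite m2 => /(leq_trans le_n); rewrite leq_add2r => dimK.
pose i (a : 'rV[F]_n) : 'rV[L]_n := map_mx (in_alg L) a.
have [a aK a0] : exists2 a, a \in K & a != 0.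
  exists (vpick K); first exact: memv_pick.
  by rewrite vpick0 -dimv_eq0 -lt0n (leq_trans _ dimK).
have [b bK b_a] : exists2 b, b \in K & b \notin <[a]>%VS.
  apply/subvPn/negP => /dimvS; rewrite dim_vline a0.
  by move/(leq_trans dimK).
have [g _ g1] : exists2 g : L, g \in {:L}%VS & g \notin 1%VS.
  by apply/subvPn/negP => /dimvS; rewrite m2 dimv1.
(* Since 1 and [g] are [F]-independent, a [lam] that kills [v] kills both [a] and [b]. *)
pose v := i a + g *: i b.
have vC : v \in C by rewrite rpredD ?rpredZ ?KC.
have pairE lam : pairing lam v
    = ((lam *m a^T) 0 0)%:A + ((lam *m b^T) 0 0) *: g.
  rewrite !mxE !scaler_suml -big_split; apply: eq_bigr => j _ /=.
  rewrite !mxE scalerDr scalerA; congr (_ + _).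
  by rewrite -scalerAr mulr1 scalerA.
have pair0 lam : pairing lam v = 0 -> (lam *m b^T) 0 0 = 0.
  rewrite pairE => /eqP; rewrite addrC addr_eq0 => /eqP eq_g.
  apply: contraNeq g1 => nz.
  by rewrite -[g](scalerK nz) eq_g memvZ ?rpredN ?memvZ ?memv_line.
have pairi lam w : pairing lam (i w) = ((lam *m w^T) 0 0)%:A.
  rewrite !mxE scaler_suml; apply: eq_bigr => j _.
  by rewrite !mxE scalerA.
have [|al aE] := minC v (i a) vC (KC a aK).
  apply/rank_support_subP => lam pv.
  by move: (pv); rewrite pairE (pair0 _ pv) scale0r addr0 pairi.
have [|be bE] := minC v (i b) vC (KC b bK).
  apply/rank_support_subP => lam /pair0.
  by rewrite pairi => ->; rewrite scale0r.
have [j aj] : exists j, a 0 j != 0 by apply/rV0Pn.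
have aEl l : (a 0 l)%:A = al * v 0 l by move/rowP/(_ l): aE; rewrite !mxE.
have bEl l : (b 0 l)%:A = be * v 0 l by move/rowP/(_ l): bE; rewrite !mxE.
have : (a 0 j)%:A != 0 :> L by rewrite scaler_eq0 negb_or aj oner_eq0.
rewrite aEl mulf_eq0 negb_or => /andP[al0 v0].
(* Both [a] and [b] are [L]-multiples of [v], hence proportional, and their ratio, read at entry
   [j], lies in [F]. *)
case/negP: b_a; apply/vlineP; exists (b 0 j / a 0 j).
apply/rowP => l; rewrite mxE; apply: (fmorph_inj (in_alg L)).
rewrite rmorphM fmorph_div /= !aEl !bEl.
have -> : be * v 0 j / (al * v 0 j) = be / al.
  by rewrite -mulf_div divff ?mulr1.
by rewrite mulrA divfK.
Qed.

End DegreeTwo.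

(** * Codes from [F]-subspaces of [L^k] *)

Section SystemToCode.
Local Open Scope ring_scope.

Variables (F : finFieldType) (L : fieldExtType F) (k : nat).

(** Here [x] lives in an [L]-space, but [u] in a function space viewed over [F], because the
    subspace [U] below is only [F]-linear. *)
Definition dot (x : 'rV[L]_k) (u : {ffun 'I_k -> L}) : L :=
  \sum_i x 0 i * u i.

Lemma dot_is_linear x : linear (dot x).
Proof.
move=> a u v; rewrite /dot scaler_sumr -big_split; apply: eq_bigr => i _ /=.
by rewrite !ffunE mulrDr scalerAr.
Qed.

HB.instance Definition _ x := GRing.isLinear.Build F {ffun 'I_k -> L} L
  *:%R (dot x) (dot_is_linear x).

Lemma dot_scale c x (u : {ffun 'I_k -> L}) :
  dot x [ffun i => c * u i] = c * dot x u.
Proof.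
by rewrite /dot big_distrr; apply: eq_bigr => i _; rewrite ffunE mulrCA.
Qed.

Lemma dim_hyperplane (x : 'rV[L]_k) : x != 0 ->
  (\dim (lker (linfun (dot x))) + \dim {:L} = k * \dim {:L})%N.
Proof.
move=> /rV0Pn[i xi].
have fx : limg (linfun (dot x)) = fullv.
  apply/eqP; rewrite eqEsubv subvf; apply/subvP => c _.
  apply/memv_imgP; exists [ffun j => (j == i)%:R * (c / x 0 i)].
    exact: memvf.
  rewrite lfunE /= /dot (bigD1 i) //= big1 => [|j ji].
    by rewrite ffunE eqxx mul1r mulrC divfK ?addr0.
  by rewrite ffunE (negPf ji) mul0r mulr0.
rewrite -{1}fx -(capfv (lker _)) limg_ker_dim dimvf /dim /= card_ord.
by rewrite -(dimvf L).
Qed.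

(** As [y] is not proportional to [x], [dot y] still maps the hyperplane [x^perp] onto [L], so its
    kernel there loses another [\dim {:L}]. *)
Lemma dim_codim2 (x y : 'rV[L]_k) : x != 0 -> (forall a, y != a *: x) ->
  (\dim (lker (linfun (dot x)) :&: lker (linfun (dot y)))
     + \dim {:L} + \dim {:L} = k * \dim {:L})%N.
Proof.
move=> x0 yx; rewrite -(dim_hyperplane x0); congr (_ + _)%N.
have [i xi] := rV0Pn _ x0.
have [j dij] : exists j, x 0 i * y 0 j - x 0 j * y 0 i != 0.
  apply/existsP; apply: contraT; rewrite negb_exists => /forallP prop.
  case/eqP: (yx (y 0 i / x 0 i)); apply/rowP => j; rewrite mxE.
  have := prop j; rewrite negbK subr_eq0 => /eqP eq_ij.
  by apply: (mulfI xi); rewrite eq_ij mulrA [x 0 i * _]mulrC divfK // mulrC.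
(* Supported on [i] and [j], [w c] is orthogonal to [x], and [dot y] sends it to [c] times the
   nonzero minor. *)
pose w c := [ffun l => c * ((l == j)%:R * x 0 i - (l == i)%:R * x 0 j)].
have dotw z c : dot z (w c) = c * (x 0 i * z 0 j - x 0 j * z 0 i).
  rewrite /dot (eq_bigr (fun l => (l == j)%:R * (c * (x 0 i * z 0 j))
                               - (l == i)%:R * (c * (x 0 j * z 0 i)))).
    rewrite sumrB (bigD1 j) //= big1 => [|l /negPf->]; last by rewrite mul0r.
    rewrite (bigD1 i) //= [X in _ - (_ + X)]big1 => [|l /negPf->].
      by rewrite !eqxx !mul1r !addr0 mulrBr.
    by rewrite mul0r.
  move=> l _; rewrite ffunE.
  by have [->|_] := eqVneq l j; have [->|_] := eqVneq _ i => /=; ring.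
have fy : (linfun (dot y) @: lker (linfun (dot x)))%VS = fullv.
  apply/eqP; rewrite eqEsubv subvf; apply/subvP => c _; apply/memv_imgP.
  exists (w (c / (x 0 i * y 0 j - x 0 j * y 0 i))).
    by rewrite memv_ker lfunE /= dotw [x 0 j * x 0 i]mulrC subrr mulr0.
  by rewrite lfunE /= dotw divfK.
by rewrite -fy limg_ker_dim.
Qed.

(* If the implication fails to force proportionality, the codimension-2
   [L]-subspace [x^perp :&: y^perp] has the dimension of [U :&: x^perp], so it
   is contained in [U]. *)
Lemma cutting_of_codim2_free (U : {vspace {ffun 'I_k -> L}}) :
  (\dim U + \dim {:L} = k * \dim {:L})%N ->
  (forall x y, exists2 u, dot x u = 0 /\ dot y u = 0 & u \notin U) ->
  forall x y, x != 0 -> (forall u, u \in U -> dot x u = 0 -> dot y u = 0) ->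
  exists a, y = a *: x.
Proof.
move=> dimU freeU x y x0 imp.
have [/existsP[a /eqP ->]|] :=
    boolP [exists a : finvect_type L, y == (a : L) *: x].
  by exists a.
rewrite negb_exists => /forallP nprop.
pose W := (lker (linfun (dot x)) :&: lker (linfun (dot y)))%VS.
have dimW := dim_codim2 x0 nprop.
have sub : (U :&: lker (linfun (dot x)) <= W)%VS.
  apply/subvP => u /memv_capP[uU ux]; rewrite memv_cap ux memv_ker lfunE /=.
  by apply/eqP/imp => //; move: ux; rewrite memv_ker lfunE => /eqP.
(* [dot x] maps [U] into [L], so the left side has dimension at least [\dim U - \dim {:L}], which is
   [\dim W]. *)
have eqW : (U :&: lker (linfun (dot x)))%VS == W.
  rewrite eqEdim sub /= -(leq_add2r (\dim {:L})) -(leq_add2r (\dim {:L})).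
  rewrite dimW -dimU leq_add2r -(limg_ker_dim (linfun (dot x)) U) leq_add2l.
  exact/dimvS/subvf.
have [u [xu yu] /negP[]] := freeU x y.
apply: (subvP (capvSl U (lker (linfun (dot x))))).
by rewrite (eqP eqW) memv_cap !memv_ker !lfunE /= xu yu eqxx.
Qed.

(** With an [F]-basis of [U] as columns of [G], the annihilator of the support of [x *m G] is
    identified with the part of [U] orthogonal to [x]. The spanning hypothesis makes encoding
    injective, the cutting one gives minimality, and nondegeneracy is the [F]-independence of the
    columns. *)
Lemma code_of_system n (U : {vspace {ffun 'I_k -> L}}) :
  \dim U = n ->
  (forall x, (forall u, u \in U -> dot x u = 0) -> x = 0) ->
  (forall x y, (forall u, u \in U -> dot x u = 0 -> dot y u = 0) ->
     exists a, y = a *: x) ->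
  exists C : {vspace 'rV[L]_n},
    [/\ \dim C = k, nondegenerate_code C & minimal_code C].
Proof.
move=> <- spanU cutU.
pose G : 'M[L]_(k, \dim U) := \matrix_(i, j) (vbasis U)`_j i.
pose f := linfun (mulmxr G : 'rV[L]_k -> 'rV[L]_(\dim U)).
have fE x : f x = x *m G by rewrite lfunE.
have fdot x j : f x 0 j = dot x (vbasis U)`_j.
  by rewrite fE mxE; apply: eq_bigr => i _; rewrite mxE.
have pairE lam x : pairing lam (f x) = dot x (\sum_j lam 0 j *: (vbasis U)`_j).
  by rewrite linear_sum; apply: eq_bigr => j _; rewrite linearZ fdot.
have Ulam u : u \in U ->
    exists lam : 'rV[F]_(\dim U), u = \sum_j lam 0 j *: (vbasis U)`_j.
  move=> uU; exists (\row_j coord (vbasis U) j u).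
  by rewrite {1}(coord_vbasis uU); apply: eq_bigr => j _; rewrite mxE.
exists (limg f); split.
- rewrite limg_dim_eq ?dim_rowv //.
  rewrite capfv; apply/eqP; rewrite -subv0; apply/subvP => x.
  rewrite memv_ker memv0 => /eqP fx0; apply/eqP/spanU => u /Ulam[lam ->].
  rewrite -pairE fx0 /pairing big1 // => j _; by rewrite mxE scaler0.
- apply: nondegenerate_codeP => lam kill.
  have sum0 : \sum_j lam 0 j *: (vbasis U)`_j = 0.
    apply/ffunP => i; rewrite ffunE.
    have := kill _ (memv_img f (memvf (delta_mx 0 i))).
    rewrite pairE /dot (bigD1 i) //= [X in _ + X]big1 => [|l li].
      by rewrite addr0 mxE !eqxx mul1r.
    by rewrite mxE (negPf li) mul0r.
  have /freeP/(_ (lam 0) sum0) lam0 := basis_free (vbasisP U).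
  by apply/rowP => j; rewrite lam0 mxE.
- move=> v w /memv_imgP[x _ ->] /memv_imgP[y _ ->] /rank_support_subP sub.
  have [|a ->] := cutU x y; last by exists a; rewrite linearZ.
  by move=> u /Ulam[lam ->]; rewrite -!pairE; apply: sub.
Qed.

End SystemToCode.

(** * A subspace cut out by conditions on three coordinates *)

Section TripleSystem.
Local Open Scope ring_scope.

Variables (F : finFieldType) (L : fieldExtType F) (k : nat).

(** On the first three coordinates this is two equations in three unknowns; a nonzero solution is
    padded with zeros. *)
Lemma codim2_triple (x y : 'rV[L]_(3 + k)) :
  exists2 u : {ffun 'I_(3 + k) -> L}, dot x u = 0 /\ dot y u = 0 &
    exists i : 'I_3, u (lshift k i) != 0.
Proof.
pose A : 'M[L]_(3, 1 + 1) := row_mx (lsubmx x)^T (lsubmx y)^T.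
have [v vA v0] : exists2 v : 'rV_3, (v <= kermx A)%MS & v != 0.
  apply/rowV0Pn; rewrite -mxrank_eq0 mxrank_ker -lt0n subn_gt0.
  exact: leq_ltn_trans (rank_leq_col A) _.
move/sub_kermxP: vA; rewrite mul_mx_row -[0]row_mx0 => /eq_row_mx[vx vy].
pose u : {ffun 'I_(3 + k) -> L} := [ffun i => row_mx v 0 0 i].
have dotu z : v *m (lsubmx z)^T = 0 -> dot z u = 0.
  move=> /matrixP/(_ 0 0); rewrite mxE mxE => vz.
  rewrite /dot big_split_ord /= [X in _ + X]big1 => [|i _].
    rewrite addr0 -[RHS]vz; apply: eq_bigr => i _.
    by rewrite ffunE row_mxEl !mxE mulrC.
  by rewrite ffunE row_mxEr mxE mulr0.
exists u; first by rewrite !dotu.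
by have [i vi] := rV0Pn _ v0; exists i; rewrite ffunE row_mxEl.
Qed.

Let m := \dim {:L}.
Let b := vbasis {:L}.

(** Conditions 0 and 1 get coordinates 0 and 1, and all later ones share coordinate 2; [inord] never
    takes its default value. *)
Definition slot (j : 'I_m) : 'I_(3 + k) := lshift k (inord (minn j 2)).

Definition slot_coord (u : {ffun 'I_(3 + k) -> L}) : 'rV[F]_m :=
  \row_j coord b j (u (slot j)).

Lemma slot_coord_is_linear : linear slot_coord.
Proof.
by move=> a u v; apply/rowP => j; rewrite !mxE !ffunE linearP.
Qed.

HB.instance Definition _ := GRing.isLinear.Build F {ffun 'I_(3 + k) -> L}
  'rV[F]_m *:%R slot_coord slot_coord_is_linear.

Definition slot_system : {vspace {ffun 'I_(3 + k) -> L}} :=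
  lker (linfun slot_coord).

Lemma mem_slot_system u :
  (u \in slot_system) = (slot_coord u == 0).
Proof. by rewrite memv_ker lfunE. Qed.

Lemma coord_vbasis_nth (i j : 'I_m) : coord b i b`_j = (j == i)%:R.
Proof. by apply: coord_free; apply: basis_free (vbasisP _). Qed.

(** The conditions are independent even where they share a coordinate, since each reads a different
    basis coordinate of the entry. *)
Lemma dim_slot_system : (\dim slot_system + m = (3 + k) * m)%N.
Proof.
have fullS : limg (linfun slot_coord) = fullv.
  apply/eqP; rewrite eqEsubv subvf; apply/subvP => r _; apply/memv_imgP.
  exists [ffun i => \sum_(j | slot j == i) r 0 j *: b`_j]; first exact: memvf.
  apply/rowP => l; rewrite lfunE mxE ffunE linear_sum (bigD1 l) //= big1.
    by rewrite linearZ /= coord_vbasis_nth eqxx mulr1 addr0.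
  by move=> j /andP[_ /negPf jl]; rewrite linearZ /= coord_vbasis_nth jl mulr0.
have := limg_ker_dim (linfun slot_coord) fullv.
by rewrite fullS dim_rowv capfv dimvf /dim /= card_ord -(dimvf L).
Qed.

Hypothesis m3 : (3 <= m)%N.

Lemma slot_onto (i : 'I_3) : exists j, slot j = lshift k i.
Proof.
exists (widen_ord m3 i); congr lshift; apply/val_inj.
by rewrite /= inordK ?(minn_idPl _) // -ltnS.
Qed.

Lemma slot_system_codim2_free x y :
  exists2 u, dot x u = 0 /\ dot y u = 0 & u \notin slot_system.
Proof.
have [u [xu yu] [i ui]] := codim2_triple x y.
have [j ji] := slot_onto i.
(* The scaling makes the entry at [slot j] equal to [b_j], whose [j]-th coordinate is 1. *)
exists [ffun l => b`_j / u (slot j) * u l].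
  by rewrite !dot_scale xu yu mulr0.
rewrite mem_slot_system; apply/eqP => /rowP/(_ j); rewrite !mxE ffunE.
by rewrite ji divfK // coord_vbasis_nth eqxx => /eqP; rewrite oner_eq0.
Qed.

(** For each [i], some condition [j] does not bear on entry [i]. The vector with [b_j] at [i] and
    zeros elsewhere then satisfies every condition, and forces [x_i = 0]. *)
Lemma slot_system_span x :
  (forall u, u \in slot_system -> dot x u = 0) -> x = 0.
Proof.
move=> kill; apply/rowP => i; rewrite mxE.
have [j ji] : exists j, slot j != i.
  have [j0 j0E] := slot_onto 0; have [j1 j1E] := slot_onto 1.
  have [j0i|] := eqVneq (slot j0) i; last by exists j0.
  by exists j1; rewrite -j0i j0E j1E.
pose u : {ffun 'I_(3 + k) -> L} := [ffun l => (l == i)%:R * b`_j].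
have uU : u \in slot_system.
  rewrite mem_slot_system; apply/eqP/rowP => l; rewrite !mxE ffunE.
  have [li|_] := eqVneq (slot l) i; last by rewrite mul0r linear0.
  rewrite mul1r coord_vbasis_nth; case: eqVneq => // lj.
  by rewrite lj li eqxx in ji.
have := kill u uU; rewrite /dot (bigD1 i) //= big1 => [|l /negPf li].
  rewrite ffunE eqxx mul1r addr0 => /eqP; rewrite mulf_eq0 => /orP[/eqP //|].
  move/eqP => bj0; have := coord_vbasis_nth j j.
  by move/eqP; rewrite bj0 linear0 eqxx eq_sym oner_eq0.
by rewrite ffunE li mul0r mulr0.
Qed.

End TripleSystem.

Theorem corollary6p20 (q m k : nat) (F : finFieldType) (L : fieldExtType F)
    (hq : #|F| = q) (hm : \dim {:L} = m) (hk : 3 <= k) :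
  (exists C : {vspace 'rV[L]_((k - 1) * m)},
      [/\ \dim C = k, nondegenerate_code C & minimal_code C]) <-> 3 <= m.
Proof.
case: k hk => [|[|[|k]]] // _; split=> [[C [dimC _ minC]]|m3].
  have m_gt0 : 0 < m by rewrite -hm adim_gt0.
  case: m m_gt0 hm C dimC minC => [|[|[|m]]] // _ hm C dimC minC.
    by have := dimvS (subvf C); rewrite dimC dim_rowv muln1 subn1 ltnn.
  (* For [m = 2] the dimension bound holds with equality: in the original [k],
     [2 + (k - 2) * 2 = (k - 1) * 2]. *)
  case: (@quadratic_not_minimal F L _ C hm _ minC).
  by rewrite dimC; lia.
rewrite -hm in m3 *; have dimU := dim_slot_system L k.
apply: (@code_of_system _ _ _ _ (slot_system L k)).
- by apply/(@addIn (\dim {:L})); rewrite dimU -mulSnr subn1.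
- exact: slot_system_span.
(* If [x = 0], then [y] is orthogonal to all of [U], hence zero; the codimension count needs [x]
   nonzero. *)
move=> x y imp; have [x0|x0] := eqVneq x 0%R.
  exists 0%R; rewrite GRing.scale0r; apply: slot_system_span => // u uU.
  apply: imp => //; rewrite x0 /dot big1 // => i _.
  by rewrite mxE GRing.mul0r.
apply: cutting_of_codim2_free (x0) imp => //.
exact: slot_system_codim2_free.
Qed.
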